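(* Let $n\geq 3$, $s\in(0,2)$, $2^\star=\frac{2(n-s)}{n-2}$, and let $u\in C^2(\mathbb{R}^n_-)\cap C^1(\overline{\mathbb{R}^n_-})$ satisfy $$\Delta u=\frac{u^{2^\star-1}}{|x|^s}\ \text{ in }\mathbb{R}^n_-,\qquad u>0\ \text{ in }\mathbb{R}^n_-,\qquad u=0\ \text{ on }\partial\mathbb{R}^n_-.$$ Assume that for some $C>0$, $u(x)\leq C(1+|x|)^{1-n}$ for all $x\in\mathbb{R}^n_-$. Then $u\circ\sigma=u$ for every isometry $\sigma$ of $\mathbb{R}^n$ such that $\sigma(\mathbb{R}^n_-)=\mathbb{R}^n_-$ and $\sigma(0)=0$. In particular, there exists $v\in C^2(\mathbb{R}_-^\star\times\mathbb{R})\cap C^1(\mathbb{R}_-\times\mathbb{R})$ such that for all $x_1<0$ and all $x'\in\mathbb{R}^{n-1}$, $u(x_1,x')=v(x_1,|x'|)$.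
   Context: $\mathbb{R}^n_-=\{x\in\mathbb{R}^n: x_1<0\}$, where $x_1$ is the first coordinate of $x$; points are written $x=(x_1,x')$ with $x'\in\mathbb{R}^{n-1}$. $\Delta=-\sum_i\partial_{ii}$ is the Laplacian with the minus sign convention. $\mathbb{R}_-=(-\infty,0]$ and $\mathbb{R}_-^\star=(-\infty,0)$. *)

(* Defs.v *)
From HB Require Import structures.
From mathcomp Require Import all_boot all_order all_algebra.
From mathcomp Require Import all_classical all_reals all_analysis.

Set Implicit Arguments.
Unset Strict Implicit.
Unset Printing Implicit Defensive.

Import Order.TTheory GRing.Theory Num.Theory.
Import numFieldNormedType.Exports.

Local Open Scope classical_set_scope.
Local Open Scope ring_scope.

(* The norm `|x| that the library puts on 'rV[R]_n is the sup norm, so the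
   Euclidean norm has to be defined. Both induce the same topology. *)
Definition enorm (R : realType) (n : nat) (x : 'rV[R]_n) : R :=
  Num.sqrt (\sum_(i < n) x 0 i ^+ 2).

(* (a, y) in R x R^n, seen as a point of R^(n+1). *)
Definition consr (R : realType) (n : nat) (a : R) (y : 'rV[R]_n) : 'rV[R]_n.+1 :=
  row_mx (a%:M : 'M[R]_1) y.

Definition halfspace (R : realType) (n : nat) : set 'rV[R]_n.+1 :=
  [set x | x 0 ord0 < 0].

Definition closed_halfspace (R : realType) (n : nat) : set 'rV[R]_n.+1 :=
  [set x | x 0 ord0 <= 0].

Arguments halfspace : clear implicits.
Arguments closed_halfspace : clear implicits.

Definition unit_vec (R : realType) (n : nat) (i : 'I_n) : 'rV[R]_n :=
  delta_mx 0 i.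

Definition partial (R : realType) (n : nat) (i : 'I_n) (f : 'rV[R]_n -> R) :
    'rV[R]_n -> R :=
  fun x => 'D_(unit_vec R i) f x.

(* f is of class C^k on A, for A open: all partial derivatives up to order k
   exist and are continuous on A. *)
Fixpoint class_C (R : realType) (n k : nat) (A : set 'rV[R]_n)
    (f : 'rV[R]_n -> R) : Prop :=
  {within A, continuous f} /\
  if k is k'.+1 then
    forall i : 'I_n,
      (forall x, A x -> derivable f x (unit_vec R i)) /\
      class_C k' A (partial i f)
  else True.

(* f is of class C^1 up to the boundary on the closed half-space: f is C^1 on
   the open half-space, and f and its first partial derivatives extend
   continuously to the closed half-space. Values of f outside the closed
   half-space are irrelevant. *)
Definition C1_closed_halfspace (R : realType) (n : nat)
    (f : 'rV[R]_n.+1 -> R) : Prop :=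
  [/\ class_C 1 (halfspace R n) f,
      {within closed_halfspace R n, continuous f} &
      forall i : 'I_n.+1, exists g : 'rV[R]_n.+1 -> R,
        {within closed_halfspace R n, continuous g} /\
        (forall x, halfspace R n x -> g x = partial i f x)].

(* The geometers' (nonnegative) Laplacian: minus the sum of the second
   derivatives. *)
Definition laplacian (R : realType) (n : nat) (f : 'rV[R]_n -> R) :
    'rV[R]_n -> R :=
  fun x => - \sum_(i < n) partial i (partial i f) x.

Definition eisometry (R : realType) (n : nat) (sigma : 'rV[R]_n -> 'rV[R]_n) :
    Prop :=
  forall x y, enorm (sigma x - sigma y) = enorm (x - y).

Definition crit_exp (R : realType) (n : nat) (s : R) : R :=
  2 * (n%:R - s) / (n%:R - 2).

(* Main.v *)
Require Import Defs.
From HB Require Import structures.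
From mathcomp Require Import all_boot all_order all_algebra.
From mathcomp Require Import all_classical all_reals all_analysis.
From mathcomp Require Import ring lra.

Set Implicit Arguments.
Unset Strict Implicit.
Unset Printing Implicit Defensive.

Import Order.TTheory GRing.Theory Num.Theory.
Import numFieldNormedType.Exports.

Local Open Scope classical_set_scope.
Local Open Scope ring_scope.

(** The solution is invariant under every reflection that exchanges two points
    [x], [y] of the half-space with [x 0 ord0 = y 0 ord0] and the same norm; this
    gives both claims, since an isometry that fixes the origin and the half-space
    preserves the first coordinate and the norm, and since [(x1, x')] and
    [(x1, |x'| e)] are two such points.

    The inequality [u x <= u y] is obtained by moving planes parallel to [e], for
    a unit vector [e] orthogonal to the first axis. For [l > 0] let [rho] be the
    reflection in the hyperplane [dot x e = l], and let the cap be the part of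
    the half-space where [dot x e > l]. In the cap [rho] decreases the norm, so
    that [w := u o rho - u] satisfies there
      [laplacian w >= - c * (u - u o rho)], [c := p * u ^ (p - 1) / |x| ^ s],
    wherever [w < 0], with [p] the exponent of the equation. The decay assumed on
    [u] makes [c] decay like [|x| ^ (s - 4)], which is faster than [|x| ^ (- 2)]
    because [s < 2], and the weight [|x| ^ (- s)] is bounded in the cap because
    [l > 0] keeps the origin away ([potential_decay]).

    A single function serves as a comparison function both at infinity and close
    to the boundary of the cap: the [barrier], which lies between 1 and 4 and
    whose Laplacian dominates [4 c] outside a large ball, and also in a strip of
    width [1 / k] along each of the two boundary hyperplanes. If [w] takes a
    negative value, [w / barrier] has a negative interior minimum, and the second
    derivative test there shows that the minimum lies in a compact part of the
    open cap, uniformly for [l >= l0 > 0] ([violation_confined]).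

    Suppose now that [w] takes a negative value for [l0]. Among the pairs [(l, x)]
    with [l >= l0], [x] in the compact part and [w x <= 0], take one for which [l]
    is maximal. No larger [l] admits a negative value, hence neither does this
    [l], by continuity; so [w] has an interior minimum with value 0 at [x]. There
    [laplacian w <= 0], whereas the equation gives
    [laplacian w = u x ^ p * (|rho x| ^ (- s) - |x| ^ (- s)) > 0]. Hence [w >= 0]
    for every [l > 0] ([moving_planes]), and letting [l] tend to 0 gives the
    inequality between [u x] and its value at the mirror image.

    The Laplacian enters only through second derivatives of restrictions to
    lines. That reflections preserve it rests on the fact that for a function of
    class C^2 the second derivative along any line is the Hessian quadratic form
    ([second_derive_line]), which reduces to the mean value theorem
    ([is_derive_add_dir]). *)

(** * Second derivatives along lines *)

Section Calculus.
Context {R : realType}.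

Lemma is_derive_cvg (V : normedModType R) (f : V -> R) (x v : V) (d : R) :
  h^-1 *: (f (h *: v + x) - f x) @[h --> (0:R)^'] --> d -> is_derive x v f d.
Proof.
move=> fd; split; first by apply/cvg_ex; exists d.
exact: cvg_lim fd.
Qed.

Lemma is_derive_cvgP (V : normedModType R) (f : V -> R) (x v : V) (d : R) :
  is_derive x v f d -> h^-1 *: (f (h *: v + x) - f x) @[h --> (0:R)^'] --> d.
Proof. by move=> [fd <-]; exact: fd. Qed.

Lemma is_derive_line (V : normedModType R) (f : V -> R) (x v : V) (h d : R) :
  is_derive (h *: v + x) v f d -> is_derive h 1 (fun t => f (t *: v + x)) d.
Proof.
move=> /is_derive_cvgP fd; apply: is_derive_cvg.
have -> // : (fun k => k^-1 *: (f ((k *: (1 : R) + h) *: v + x) - f (h *: v + x)))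
  = (fun k => k^-1 *: (f (k *: v + (h *: v + x)) - f (h *: v + x))).
by apply/funext => k; rewrite [k *: 1]mulr1 scalerDl -addrA.
Qed.

Lemma MVT_near0 (g dg : R -> R) (t : R) :
  (forall c : R, `|c| <= `|t| -> is_derive c 1 g (dg c)) ->
  exists2 c : R, `|c| <= `|t| & g t - g 0 = dg c * t.
Proof.
move=> gd.
have cg c : `|c| <= `|t| -> {for c, continuous g}.
  by move=> /gd [+ _] => /derivable1_diffP /differentiable_continuous.
have [t0|t0|->] := ltgtP t 0.
- have [||c] := @MVT R g dg t 0 t0.
  + move=> c; rewrite in_itv/= => /andP[tc c0]; apply: gd.
    by rewrite (ltr0_norm t0) (ltr0_norm c0) lerN2 ltW.
  + apply: continuous_in_subspaceT => c.
    rewrite inE/= in_itv/= => /andP[tc c0]; apply: cg.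
    by rewrite (ltr0_norm t0) (ler0_norm c0) lerN2.
  rewrite in_itv/= => /andP[tc c0] E; exists c; last by lra.
  by rewrite (ltr0_norm t0) (ltr0_norm c0) lerN2 ltW.
- have [||c] := @MVT R g dg 0 t t0.
  + move=> c; rewrite in_itv/= => /andP[tc c0]; apply: gd.
    by rewrite (gtr0_norm t0) (gtr0_norm tc) ltW.
  + apply: continuous_in_subspaceT => c.
    rewrite inE/= in_itv/= => /andP[tc c0]; apply: cg.
    by rewrite (gtr0_norm t0) (ger0_norm tc).
  rewrite in_itv/= => /andP[tc c0] E; exists c; last by lra.
  by rewrite (gtr0_norm t0) (gtr0_norm tc) ltW.
by exists 0; rewrite ?subrr ?mulr0.
Qed.

(** The step from partial derivatives to directional ones: the increment of [f]
    along [v + a *: e] is the increment along [v] plus an increment along [e]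
    based at a nearby point, and the latter is controlled by the mean value
    theorem and the continuity of the derivative along [e]. *)
Lemma is_derive_add_dir (V : normedModType R) (f : V -> R) (x v e : V)
  (d : R) (df : V -> R) (a : R) :
  is_derive x v f d -> (\forall y \near x, is_derive y e f (df y)) ->
  {for x, continuous df} -> is_derive x (v + a *: e) f (d + a * df x).
Proof.
move=> fv fe cdf; apply: is_derive_cvg.
have -> : (fun h => h^-1 *: (f (h *: (v + a *: e) + x) - f x)) =
  (fun h => h^-1 *: (f (h *: v + x) - f x) +
            h^-1 *: (f ((h * a) *: e + (h *: v + x)) - f (h *: v + x))).
  apply/funext => h; rewrite -scalerDr; congr (_ *: _).
  by rewrite [RHS]addrC addrA subrK scalerDr scalerA -addrA addrCA.
apply: cvgD; first exact: is_derive_cvgP.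
apply/cvgrPdist_le => eps eps0.
have e1 : 0 < eps / (1 + `|a|) by rewrite divr_gt0// ltr_pwDl.
have /cvgrPdist_le /(_ _ e1) cdf' := cdf.
have : \forall y \near x, is_derive y e f (df y) /\
    `|df x - df y| <= eps / (1 + `|a|) by exact: filterI.
move=> /nbhs_ballP [r /= r0 rP].
pose M := (`|a| * `|e| + `|v| + 1).
(* A bound for how far the intermediate points are from [x], relative to [h]. *)
have M0 : 0 < M by rewrite /M ltr_wpDl// addr_ge0// mulr_ge0.
near=> h.
have hr : `|h| * M < r.
  rewrite -ltr_pdivlMr//; near: h; apply: dnbhs0_lt.
  by rewrite divr_gt0.
have h0 : h != 0 by near: h; exact: nbhs_dnbhs_neq.
have inb c : `|c| <= `|h * a| -> ball x r (c *: e + (h *: v + x)).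
  move=> cha; rewrite -ball_normE/= [_ + (h *: v + x)]addrA opprD addrCA subrr addr0.
  rewrite normrN; apply: le_lt_trans hr.
  apply: (le_trans (ler_normD _ _)); rewrite !normrZ /M.
  have := ler_wpM2r (normr_ge0 e) cha; rewrite normrM => h1.
  have := normr_ge0 h; lra.
have gd (c : R) : `|c| <= `|h * a| ->
    is_derive (c : R) 1 (fun t => f (t *: e + (h *: v + x))) (df (c *: e + (h *: v + x))).
  by move=> cle; apply: is_derive_line; exact: (rP _ (inb c cle)).1.
have [c ca] := MVT_near0 gd.
rewrite /= scale0r add0r => ->.
have /= := (rP _ (inb c ca)).2; set D := df (_ + _) => De.
have -> : h^-1 *: (D * (h * a)) = a * D by rewrite /GRing.scale/=; field.
rewrite -mulrBr normrM.
apply: (le_trans (ler_wpM2l (normr_ge0 _) De)).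
rewrite mulrA ler_pdivrMr ?ltr_pwDl// mulrC ler_pM2l//.
by rewrite lerDr.
Unshelve. all: by end_near. Qed.

(** Adding the coordinate directions one at a time with [is_derive_add_dir]. *)
Lemma is_derive_sum_partial (n : nat) (A : set 'rV[R]_n) (f : 'rV[R]_n -> R)
  (x v : 'rV[R]_n) : open A -> A x ->
  (forall i y, A y -> derivable f y (unit_vec R i)) ->
  (forall i y, A y -> {for y, continuous (partial i f)}) ->
  is_derive x v f (\sum_i v 0 i * partial i f x).
Proof.
move=> oA Ax fd cf; rewrite {1}(row_sum_delta v).
elim: (index_enum _) => [|i r IH].
  by rewrite !big_nil; exact: is_derive0.
rewrite !big_cons addrC [X in is_derive _ _ _ X]addrC.
apply: is_derive_add_dir => //; last exact: cf.
have : nbhs x A by exact: open_nbhs_nbhs.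
by apply: filterS => y Ay; apply: derivableP; exact: fd.
Qed.

Lemma class_C_continuous (n k : nat) (A : set 'rV[R]_n) (f : 'rV[R]_n -> R) :
  open A -> class_C k A f -> forall x, A x -> {for x, continuous f}.
Proof.
move=> oA fC x Ax; have {fC} fc : {within A, continuous f} by case: k fC => [|k] [].
by move: fc; rewrite continuous_open_subspace// => /(_ x); apply; rewrite inE.
Qed.

(** A relation rather than an iterated [derive], so that only differentiability
    near 0 is needed and sums and multiples are immediate. *)
Definition second_derive (g : R -> R) (d : R) :=
  exists2 g' : R -> R, (\forall h \near (0:R), is_derive (h : R) 1 g (g' h))
                     & is_derive (0:R) 1 g' d.

Lemma second_derive_eq (g f : R -> R) (d d' : R) :
  second_derive g d -> g = f -> d = d' -> second_derive f d'.
Proof. by move=> + <- <-. Qed.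

Lemma second_deriveD (f g : R -> R) (a b : R) :
  second_derive f a -> second_derive g b -> second_derive (f + g) (a + b).
Proof.
move=> [f' ff' f'a] [g' gg' g'b]; exists (f' + g'); last exact: is_deriveD.
by near do apply: is_deriveD.
Unshelve. all: by end_near. Qed.

Lemma second_deriveZ (f : R -> R) (k a : R) :
  second_derive f a -> second_derive (k *: f) (k * a).
Proof.
move=> [f' ff' f'a]; exists (k *: f'); last exact: is_deriveZ.
by near do apply: is_deriveZ.
Unshelve. all: by end_near. Qed.

Lemma second_derive_line (n : nat) (A : set 'rV[R]_n) (f : 'rV[R]_n -> R)
  (x v : 'rV[R]_n) : open A -> A x -> class_C 2 A f ->
  second_derive (fun h => f (h *: v + x))
    (\sum_i \sum_j v 0 i * v 0 j * partial j (partial i f) x).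
Proof.
move=> oA Ax fC.
have [_ fi] := fC.
exists (fun h => \sum_i v 0 i * partial i f (h *: v + x)).
  have Anear : \forall h \near (0:R), A (h *: v + x).
    have : (h *: v + x) @[h --> (0:R)] --> x.
      rewrite -[X in _ --> X]add0r -(scale0r v).
      apply: cvgD; last exact: cvg_cst.
      by apply: cvgZr_tmp; exact: cvg_id.
    by apply; exact: open_nbhs_nbhs.
  near=> h; apply: is_derive_line.
  apply: (@is_derive_sum_partial _ A) => //.
  - by near: h.
  - by move=> i y Ay; apply: (fi i).1.
  - by move=> i y Ay; apply: (@class_C_continuous _ 1 A) => //; exact: (fi i).2.
have -> : (fun h => \sum_i v 0 i * partial i f (h *: v + x)) =
  \sum_i (fun h => v 0 i * partial i f (h *: v + x)).
  by apply/funext => h; rewrite fct_sumE.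
apply: is_derive_sum => i.
have -> : \sum_j v 0 i * v 0 j * partial j (partial i f) x =
  v 0 i *: \sum_j v 0 j * partial j (partial i f) x.
  by rewrite [RHS]mulr_sumr; apply: eq_bigr => j _; rewrite mulrA.
apply: is_deriveZ.
apply: is_derive_line; rewrite scale0r add0r.
have [_ fij] := (fi i).2.
apply: (@is_derive_sum_partial _ A) => //.
- by move=> j y Ay; apply: (fij j).1.
- by move=> j y Ay; apply: (@class_C_continuous _ 0 A) => //; exact: (fij j).2.
Unshelve. all: by end_near. Qed.

(** If [d < 0] then [g'], which vanishes at the minimum, is negative on the right
    of 0, and the mean value theorem gives a smaller value of [g]. *)
Lemma second_derive_min_ge0 (g : R -> R) (d : R) :
  second_derive g d -> (\forall h \near (0:R), g 0 <= g h) -> 0 <= d.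
Proof.
move=> [g' gg' g'd] gmin; rewrite leNgt; apply/negP => d0.
have g'0 : g' 0 = 0.
  have : \forall h \near (0:R), is_derive (h : R) 1 g (g' h) /\ g 0 <= g h by exact: filterI.
  move=> /nbhs_ballP [r /= r0 rP].
  have rin (h : R) : h \in `](- r), r[ -> ball (0:R) r h.
    by rewrite in_itv/= => /andP[h1 h2]; rewrite -ball_normE/= sub0r normrN ltr_norml h1 h2.
  have H : is_derive (0:R) 1 g 0.
    apply: (@derive1_at_min R g (- r) r 0).
    - by lra.
    - by move=> t /rin /rP [[]].
    - by rewrite in_itv/= r0 andbT oppr_lt0.
    - by move=> t /rin /rP [].
  have [_ <-] : is_derive (0:R) 1 g (g' 0) by exact: (nbhs_singleton gg').
  by case: H.
have /is_derive_cvgP g'lim := g'd.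
have neg : \forall h \near (0:R)^', h^-1 *: (g' (h *: 1 + 0) - g' 0) < 0.
  exact: (cvgr_lt d).
have : \forall h \near (0:R), [/\ is_derive (h : R) 1 g (g' h), g 0 <= g h &
   h != 0 -> h^-1 *: (g' (h *: 1 + 0) - g' 0) < 0].
  near=> h; split; [by near: h|by near: h|].
  by near: h.
move=> /nbhs_ballP [r /= r0 rP].
have rin (h : R) : 0 <= h -> h < r -> ball (0:R) r h.
  by move=> h0 hr; rewrite -ball_normE/= sub0r normrN ger0_norm.
have r2 : 0 < r / 2 by rewrite divr_gt0.
have gd (c : R) : 0 <= c -> c <= r / 2 -> is_derive (c : R) 1 g (g' c).
  move=> c0 cr; have cr' : c < r by lra.
  by have [] := rP c (rin _ c0 cr').
have [||c] := @MVT R g g' 0 (r / 2) r2.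
- by move=> c; rewrite in_itv/= => /andP[c0 c1]; apply: gd; exact: ltW.
- apply: continuous_in_subspaceT => c; rewrite inE/= in_itv/= => /andP[c0 c1].
  have [+ _] := gd c c0 c1.
  by move=> /derivable1_diffP /differentiable_continuous.
rewrite in_itv/= => /andP[c0 c1] E.
have r2r : r / 2 < r by lra.
have [_ gr _] := rP _ (rin _ (ltW r2) r2r).
have [_ _ gc] := rP _ (rin _ (ltW c0) (lt_trans c1 r2r)).
have := gc (lt0r_neq0 c0).
rewrite g'0 subr0 [c *: 1]mulr1 addr0 [_ *: _]mulrC pmulr_llt0 ?invr_gt0// => g'c.
have : g' c * (r / 2 - 0) < 0 by rewrite subr0 pmulr_llt0.
by rewrite -E subr_lt0 ltNge gr.
Unshelve. all: by end_near. Qed.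

End Calculus.

(** * Euclidean geometry and reflections *)

Section Euclid.
Context {R : realType}.

Definition dot (n : nat) (x y : 'rV[R]_n) : R := \sum_i x 0 i * y 0 i.

Lemma dotC (n : nat) (x y : 'rV[R]_n) : dot x y = dot y x.
Proof. by apply: eq_bigr => i _; rewrite mulrC. Qed.

Lemma dotDl (n : nat) (x y z : 'rV[R]_n) : dot (x + y) z = dot x z + dot y z.
Proof. by rewrite -big_split; apply: eq_bigr => i _; rewrite mxE mulrDl. Qed.

Lemma dotZl (n : nat) (a : R) (x y : 'rV[R]_n) : dot (a *: x) y = a * dot x y.
Proof. by rewrite mulr_sumr; apply: eq_bigr => i _; rewrite mxE mulrA. Qed.

Lemma dotDr (n : nat) (x y z : 'rV[R]_n) : dot z (x + y) = dot z x + dot z y.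
Proof. by rewrite ![dot z _]dotC dotDl. Qed.

Lemma dotZr (n : nat) (a : R) (x y : 'rV[R]_n) : dot x (a *: y) = a * dot x y.
Proof. by rewrite ![dot x _]dotC dotZl. Qed.

Lemma dotNl (n : nat) (x y : 'rV[R]_n) : dot (- x) y = - dot x y.
Proof. by rewrite -scaleN1r dotZl mulN1r. Qed.

Lemma dotNr (n : nat) (x y : 'rV[R]_n) : dot x (- y) = - dot x y.
Proof. by rewrite ![dot x _]dotC dotNl. Qed.

Definition dotE := (dotDl, dotDr, dotNl, dotNr, dotZl, dotZr).

Lemma dot_ge0 (n : nat) (x : 'rV[R]_n) : 0 <= dot x x.
Proof. by apply: sumr_ge0 => i _; rewrite -expr2 sqr_ge0. Qed.

Lemma dot_eq0 (n : nat) (x : 'rV[R]_n) : dot x x = 0 -> x = 0.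
Proof.
move=> /eqP; rewrite psumr_eq0; last by move=> i _; rewrite -expr2 sqr_ge0.
move=> /allP x0; apply/rowP => i; rewrite mxE; apply/eqP.
by have := x0 i (mem_index_enum _); rewrite mulf_eq0 orbb.
Qed.

Lemma dot_unit (n : nat) (x : 'rV[R]_n) (i : 'I_n) : dot x (unit_vec R i) = x 0 i.
Proof.
rewrite /dot (bigD1 i)//= big1; first by rewrite !mxE !eqxx mulr1 addr0.
by move=> j ji; rewrite !mxE eqxx (negbTE ji) mulr0.
Qed.

Lemma enorm_ge0 (n : nat) (x : 'rV[R]_n) : 0 <= enorm x.
Proof. exact: sqrtr_ge0. Qed.

Lemma enorm_sqr (n : nat) (x : 'rV[R]_n) : enorm x ^+ 2 = dot x x.
Proof.
rewrite sqr_sqrtr; last by apply: sumr_ge0 => i _; rewrite sqr_ge0.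
by apply: eq_bigr => i _; rewrite expr2.
Qed.

Lemma enormE (n : nat) (x : 'rV[R]_n) : enorm x = Num.sqrt (dot x x).
Proof. by rewrite -enorm_sqr sqrtr_sqr ger0_norm// enorm_ge0. Qed.

Lemma enorm_gt0 (n : nat) (x : 'rV[R]_n) : x != 0 -> 0 < enorm x.
Proof.
move=> x0; rewrite lt_neqAle enorm_ge0 andbT; apply: contra_neq x0 => e0.
by apply: dot_eq0; rewrite -enorm_sqr -e0 expr0n.
Qed.

(** Positivity of the squared norm of [x - dot x e *: e]. *)
Lemma dot_le_enorm (n : nat) (x e : 'rV[R]_n) : dot e e = 1 -> dot x e <= enorm x.
Proof.
move=> e1; apply: le_trans (ler_norm _) _.
rewrite -ler_sqr ?nnegrE ?enorm_ge0// enorm_sqr real_normK ?num_real//.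
have := dot_ge0 (x - dot x e *: e); rewrite !dotE e1 [dot e x]dotC; lra.
Qed.

Lemma coord_le_enorm (n : nat) (x : 'rV[R]_n) (i : 'I_n) : `|x 0 i| <= enorm x.
Proof.
rewrite -ler_sqr ?nnegrE ?enorm_ge0// enorm_sqr real_normK ?num_real//.
rewrite /dot (bigD1 i)//= expr2 lerDl.
by apply: sumr_ge0 => j _; rewrite -expr2 sqr_ge0.
Qed.

Lemma continuous_dot (n : nat) (e : 'rV[R]_n) : continuous (fun x => dot x e).
Proof.
apply: continuous_big => [|i _ x]; first exact: add_continuous.
have xi := @coord_continuous R 1 n 0 i x; exact: (cvgMr_tmp xi).
Qed.

Lemma continuous_dot2 (n : nat) : continuous (fun x : 'rV[R]_n => dot x x).
Proof.
apply: continuous_big => [|i _ x]; first exact: add_continuous.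
have xi := @coord_continuous R 1 n 0 i x; exact: (cvgM xi xi).
Qed.

Lemma continuous_enorm (n : nat) : continuous (@enorm R n).
Proof.
move=> x; have -> : @enorm R n = Num.sqrt \o (fun x => dot x x).
  by apply/funext => y; rewrite enormE.
by apply: continuous_comp; [exact: continuous_dot2|exact: sqrt_continuous].
Qed.

Lemma bounded_enorm_le (n : nat) (r : R) : bounded_set [set x : 'rV[R]_n | enorm x <= r].
Proof.
exists r; split; first exact: num_real.
move=> M rM x /= xr; rewrite [leLHS]/Num.norm/= mx_normrE; apply/bigmax_leP; split.
  by apply: le_trans (ltW rM); exact: le_trans (enorm_ge0 x) xr.
move=> [i j] _ /=; rewrite ord1; apply: le_trans (ltW rM).
exact: le_trans (coord_le_enorm _ _) xr.
Qed.

(** The reflection in the hyperplane [dot x e = l], for a unit vector [e]. *)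
Definition reflection (n : nat) (e : 'rV[R]_n) (l : R) (x : 'rV[R]_n) : 'rV[R]_n :=
  x - (2 * (dot x e - l)) *: e.

(** [reflection e 0] is the linear part of [reflection e l]. *)
Lemma reflection_line (n : nat) (e : 'rV[R]_n) (l h : R) (v x : 'rV[R]_n) :
  reflection e l (h *: v + x) = h *: reflection e 0 v + reflection e l x.
Proof.
rewrite /reflection !dotE scalerBr scalerA [RHS]addrACA -opprD -scalerDl.
by congr (_ - _ *: _); ring.
Qed.

Lemma dot_reflection (n : nat) (e : 'rV[R]_n) (l : R) (x : 'rV[R]_n) : dot e e = 1 ->
  dot (reflection e l x) (reflection e l x) = dot x x - 4 * l * (dot x e - l).
Proof. by move=> e1; rewrite /reflection !dotE e1 [dot e x]dotC; ring. Qed.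

Lemma reflection_coord (n : nat) (e : 'rV[R]_n) (l : R) (x : 'rV[R]_n) (i : 'I_n) :
  e 0 i = 0 -> reflection e l x 0 i = x 0 i.
Proof. by move=> ei; rewrite !mxE ei mulr0 subr0. Qed.

Lemma reflection_fixed (n : nat) (e : 'rV[R]_n) (x : 'rV[R]_n) : reflection e (dot x e) x = x.
Proof. by rewrite /reflection subrr mulr0 scale0r subr0. Qed.

Lemma sum_deltaM (n : nat) (i : 'I_n) (F : 'I_n -> R) :
  \sum_k ((k == i)%:R * F k) = F i.
Proof.
rewrite (bigD1 i)//= big1 ?addr0 ?eqxx ?mul1r// => k ki.
by rewrite (negbTE ki) mul0r.
Qed.

Lemma reflection_orthogonal (n : nat) (e : 'rV[R]_n) (i j : 'I_n) : dot e e = 1 ->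
  \sum_k reflection e 0 (unit_vec R k) 0 i * reflection e 0 (unit_vec R k) 0 j = (i == j)%:R.
Proof.
move=> e1.
have E k l : reflection e 0 (unit_vec R k) 0 l = (k == l)%:R - 2 * e 0 k * e 0 l.
  by rewrite /reflection dotC dot_unit subr0 !mxE eqxx eq_sym.
under eq_bigr do rewrite !E.
have -> : \sum_k ((k == i)%:R - 2 * e 0 k * e 0 i) * ((k == j)%:R - 2 * e 0 k * e 0 j)
  = \sum_k ((k == i)%:R * (k == j)%:R) - 2 * e 0 j * \sum_k ((k == i)%:R * e 0 k)
    - 2 * e 0 i * \sum_k ((k == j)%:R * e 0 k) + 4 * e 0 i * e 0 j * dot e e.
  rewrite !mulr_sumr -!sumrB -big_split/=; apply: eq_bigr => k _; ring.
by rewrite !sum_deltaM e1; ring.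
Qed.

(** The trace of a bilinear form does not depend on the orthonormal basis; the
    images of the coordinate vectors under a reflection form one. *)
Lemma sum_reflection_hessian (n : nat) (e : 'rV[R]_n) (H : 'I_n -> 'I_n -> R) : dot e e = 1 ->
  \sum_k \sum_i \sum_j reflection e 0 (unit_vec R k) 0 i * reflection e 0 (unit_vec R k) 0 j * H i j
  = \sum_i H i i.
Proof.
move=> e1; rewrite exchange_big/=; apply: eq_bigr => i _.
rewrite exchange_big/= -[RHS](sum_deltaM i (H i)); apply: eq_bigr => j _.
by rewrite -mulr_suml reflection_orthogonal// eq_sym.
Qed.

End Euclid.

(** * Traces of Hessians *)

Section Trace.
Context {R : realType}.

Lemma is_derive_affine (a b h : R) : is_derive h 1 (fun h : R => a + b * h) b.
Proof.
have -> : (fun h : R => a + b * h) = cst a + b *: (@idfun R) by [].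
have := is_deriveD (is_derive_cst a h 1) (is_deriveZ b (is_derive_id h 1)).
by rewrite add0r [_ *: _]mulr1.
Qed.

Lemma second_derive_expR (a b : R) :
  second_derive (fun h => expR (a + b * h)) (b ^+ 2 * expR a).
Proof.
have ex (h : R) : is_derive h 1 (fun h => expR (a + b * h)) (b * expR (a + b * h)).
  rewrite mulrC.
  exact: (@is_derive1_comp _ expR (fun h => a + b * h) h _ _
    (is_derive_expR _) (is_derive_affine a b h)).
exists (fun h => b * expR (a + b * h)); first by near=> h; exact: ex.
have -> : b ^+ 2 * expR a = b * (b * expR (a + b * 0)) by rewrite mulr0 addr0; ring.
exact: (is_deriveZ b (ex 0)).
Unshelve. all: by end_near. Qed.

Lemma second_derive_powR (p c b : R) : 0 < c ->
  second_derive (fun h => (c + 2 * b * h + h ^+ 2) `^ p)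
    (4 * p * (p - 1) * b ^+ 2 * c `^ (p - 2) + 2 * p * c `^ (p - 1)).
Proof.
move=> c0.
pose q (h : R) := c + 2 * b * h + h ^+ 2.
pose q' (h : R) := 2 * b + 2 * h.
have dq (h : R) : is_derive h 1 q (q' h).
  have -> : q = (fun h => c + (2 * b) * h) + (@idfun R) ^+ 2 by apply/funext => t.
  apply: (@is_derive_eq _ _ _ _ _ _ _ _ (is_deriveD (is_derive_affine c (2 * b) h)
    (is_deriveX 2 (is_derive_id h 1)))).
  by rewrite /q' expr1 [_ *: _]mulr1 mulr_natl.
have dq' (h : R) : is_derive h 1 q' 2.
  exact: is_derive_affine.
have qpos : \forall h \near (0:R), 0 < q h.
  have q0 : 0 < q 0 by rewrite /q; lra.
  have : {for 0, continuous q}.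
    by apply/differentiable_continuous/derivable1_diffP; case: (dq 0).
  by move=> /cvgr_gt; apply.
have dpow (r h : R) : 0 < q h ->
    is_derive h 1 (fun h => q h `^ r) (r * q h `^ (r - 1) * q' h).
  move=> qh; have H := is_derive1_powR r qh.
  exact: (@is_derive1_comp _ (@powR R ^~ r) q h _ _ H (dq h)).
exists (fun h => p * q h `^ (p - 1) * q' h).
  by near=> h; apply: dpow; near: h.
have q0 : q 0 = c by rewrite /q; ring.
have q'0 : q' 0 = 2 * b by rewrite /q'; ring.
have H1 : is_derive (0:R) 1 (fun h => q h `^ (p - 1)) ((p - 1) * q 0 `^ (p - 1 - 1) * q' 0).
  by apply: dpow; rewrite q0.
have H2 := is_deriveZ p H1.
have -> : (fun h => p * q h `^ (p - 1) * q' h) = (p *: (fun h => q h `^ (p - 1))) * q'.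
  by apply/funext.
apply: (@is_derive_eq _ _ _ _ _ _ _ _ (is_deriveM H2 (dq' 0))); rewrite q0 q'0.
have -> : p - 1 - 1 = p - 2 by ring.
rewrite /= q0 /GRing.scale/=; ring.
Unshelve. all: by end_near. Qed.

(** [L] is minus the Laplacian, computed from second derivatives along the
    coordinate lines through [x] only; this makes sense for functions, like the
    composite with a reflection, for which no C^2 structure has been set up. *)
Definition hessian_trace (n : nat) (F : 'rV[R]_n -> R) (x : 'rV[R]_n) (L : R) :=
  exists2 d : 'I_n -> R,
    forall i, second_derive (fun h => F (h *: unit_vec R i + x)) (d i) & \sum_i d i = L.

Variable n : nat.
Implicit Types (F G : 'rV[R]_n -> R) (x e : 'rV[R]_n).

Lemma hessian_traceD F G x a b :
  hessian_trace F x a -> hessian_trace G x b -> hessian_trace (F + G) x (a + b).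
Proof.
move=> [d Fd <-] [d' Gd <-]; exists (fun i => d i + d' i); last by rewrite big_split.
by move=> i; apply: second_deriveD.
Qed.

Lemma hessian_traceZ F x k a :
  hessian_trace F x a -> hessian_trace (k *: F) x (k * a).
Proof.
move=> [d Fd <-]; exists (fun i => k * d i); last by rewrite mulr_sumr.
by move=> i; apply: second_deriveZ.
Qed.

Lemma hessian_trace_min F x L : hessian_trace F x L ->
  (\forall y \near x, F x <= F y) -> 0 <= L.
Proof.
move=> [d Fd <-] xmin; apply: sumr_ge0 => i _.
apply: (second_derive_min_ge0 (Fd i)); rewrite scale0r add0r.
have : (h *: unit_vec R i + x) @[h --> (0:R)] --> x.
  rewrite -[X in _ --> X]add0r -(scale0r (unit_vec R i)).
  apply: cvgD; last exact: cvg_cst.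
  by apply: cvgZr_tmp; exact: cvg_id.
by move=> /(_ _ xmin).
Qed.

Lemma hessian_trace_laplacian (A : set 'rV[R]_n) F x : open A -> A x ->
  class_C 2 A F -> hessian_trace F x (- laplacian F x).
Proof.
move=> oA Ax FC; rewrite opprK.
exists (fun i => partial i (partial i F) x) => // k.
apply: second_derive_eq (second_derive_line (unit_vec R k) oA Ax FC) _ _ => //.
have ek i : unit_vec R k 0 i = (i == k)%:R by rewrite mxE eqxx.
rewrite -[RHS](sum_deltaM k (fun i => partial k (partial i F) x)).
apply: eq_bigr => i _; rewrite ek.
rewrite -(sum_deltaM k (fun j => partial j (partial i F) x)) mulr_sumr.
by apply: eq_bigr => j _; rewrite ek mulrA.
Qed.

Lemma hessian_trace_reflection (A : set 'rV[R]_n) F x e l : open A ->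
  dot e e = 1 -> A (reflection e l x) -> class_C 2 A F ->
  hessian_trace (F \o reflection e l) x (- laplacian F (reflection e l x)).
Proof.
move=> oA e1 Ax FC; rewrite opprK.
exists (fun k => \sum_i \sum_j reflection e 0 (unit_vec R k) 0 i * reflection e 0 (unit_vec R k) 0 j *
    partial j (partial i F) (reflection e l x)); last exact: sum_reflection_hessian.
move=> k; have H := second_derive_line (reflection e 0 (unit_vec R k)) oA Ax FC.
apply: second_derive_eq H _ erefl.
by apply/funext => h; rewrite [RHS]/comp reflection_line.
Qed.

Lemma hessian_trace_expR x e (k c : R) :
  hessian_trace (fun x => expR (c + k * dot x e)) x
    (k ^+ 2 * dot e e * expR (c + k * dot x e)).
Proof.
exists (fun i => (k * e 0 i) ^+ 2 * expR (c + k * dot x e)).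
  move=> i; apply: second_derive_eq (second_derive_expR _ _) _ erefl.
  by apply/funext => h; rewrite dotDl dotZl [dot (unit_vec _ _) _]dotC dot_unit; congr expR; ring.
rewrite -mulr_suml; congr (_ * _).
by rewrite /dot mulr_sumr; apply: eq_bigr => i _; ring.
Qed.

Lemma hessian_trace_powR x (p : R) :
  hessian_trace (fun x => (1 + dot x x) `^ p) x
    (4 * p * (p - 1) * dot x x * (1 + dot x x) `^ (p - 2)
     + 2 * n%:R * p * (1 + dot x x) `^ (p - 1)).
Proof.
pose c := 1 + dot x x.
have c0 : 0 < c by rewrite /c; have := dot_ge0 x; lra.
exists (fun i => 4 * p * (p - 1) * x 0 i ^+ 2 * c `^ (p - 2) + 2 * p * c `^ (p - 1)).
  move=> i; apply: second_derive_eq (second_derive_powR _ _ c0) _ erefl.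
  apply/funext => h; rewrite /c !dotE [dot (unit_vec _ _) x]dotC !dot_unit !mxE !eqxx; congr (_ `^ _).
  by rewrite /=; ring.
rewrite big_split/= sumr_const card_ord -mulr_suml -mulr_sumr; congr (_ + _).
by rewrite -mulr_natl; ring.
Qed.

Lemma hessian_trace_cst x (c : R) : hessian_trace (cst c) x 0.
Proof.
exists (fun=> 0); last by rewrite big1.
move=> i; exists (cst 0); last exact: is_derive_cst.
by near=> h; exact: is_derive_cst.
Unshelve. all: by end_near. Qed.

End Trace.

(** * The barrier and the decay of the potential *)

Section Estimates.
Context {R : realType}.

(** The convex function [y `^ p] lies above its tangent at [a]. *)
Lemma powR_tangent (p a b : R) : 1 <= p -> 0 < b -> b < a ->
  a `^ p - b `^ p <= p * a `^ (p - 1) * (a - b).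
Proof.
move=> p1 b0 ba.
have der (c : R) : b <= c -> is_derive (c : R) 1 (@powR R ^~ p) (p * c `^ (p - 1)).
  by move=> bc; apply: is_derive1_powR; exact: lt_le_trans bc.
have [||c] := @MVT R (@powR R ^~ p) (fun c => p * c `^ (p - 1)) b a ba.
- by move=> c; rewrite in_itv/= => /andP[/ltW bc _]; exact: der.
- apply: continuous_in_subspaceT => c; rewrite inE/= in_itv/= => /andP[bc _].
  by have [/derivable1_diffP /differentiable_continuous] := der c bc.
rewrite in_itv/= => /andP[bc ca] ->.
apply: ler_wpM2r; first by rewrite subr_ge0 ltW.
apply: ler_wpM2l; first by lra.
by apply: ge0_ler_powR; rewrite ?nnegrE ?subr_ge0//; lra.
Qed.

Definition potential_bound (p C l s : R) : R :=
  p * C `^ (p - 1) * ((1 + l) / l) `^ s.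

(** The exponent of [1 + r] is [(1 - N) (p - 1) - s] at first sight; since
    [(N - 2) (p - 1) = 4 - 2 s] it is at most [s - 4]. The lower bound [l <= r]
    allows [r] to be replaced by [1 + r] in the weight, at the price of the factor
    [((1 + l) / l) `^ s]. *)
Lemma potential_decay (N : nat) (p s C l r v : R) : (3 <= N)%N ->
  p = crit_exp N s - 1 -> 0 < s -> s < 2 -> 0 < C -> 0 < l -> l <= r ->
  0 < v -> v <= C * (1 + r) `^ (1 - N%:R) ->
  p * v `^ (p - 1) / r `^ s <= potential_bound p C l s * (1 + r) `^ (s - 4).
Proof.
move=> N3 pE s0 s2 C0 l0 lr v0 vC.
have N3' : 3 <= N%:R :> R by rewrite (ler_nat R 3 N).
have p1E : p - 1 = (4 - 2 * s) / (N%:R - 2).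
  rewrite pE /crit_exp; field; lra.
have p1 : 0 < p - 1 by rewrite p1E divr_gt0//; lra.
have r0 : 0 < r by lra.
have r1 : 1 <= 1 + r by lra.
have h1 : v `^ (p - 1) <= C `^ (p - 1) * (1 + r) `^ ((1 - N%:R) * (p - 1)).
  rewrite powRrM -powRM ?powR_ge0//; last exact: ltW.
  apply: ge0_ler_powR; rewrite ?nnegrE//; first exact: ltW.
  - exact: ltW.
  - by rewrite mulr_ge0// ?powR_ge0// ltW.
have h2 : (r `^ s)^-1 <= ((1 + l) / l) `^ s * (1 + r) `^ (- s).
  have B0 : 0 < (1 + r) `^ s by rewrite powR_gt0//; lra.
  have r0s : 0 < r `^ s by rewrite powR_gt0.
  rewrite powRN ler_pdivlMr// mulrC ler_pdivrMr// -powRM; last exact: ltW.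
    apply: ge0_ler_powR; rewrite ?nnegrE//; [exact: ltW|lra|..].
      by rewrite mulr_ge0 ?divr_ge0//; lra.
    rewrite mulrAC ler_pdivlMr//; nra.
  by rewrite divr_ge0//; lra.
have h3 : (1 + r) `^ ((1 - N%:R) * (p - 1)) * (1 + r) `^ (- s) <= (1 + r) `^ (s - 4).
  rewrite -powRD; last by rewrite (@gt_eqF _ _ (1 + r)) ?implybT//; lra.
  apply: ler_powR => //.
  have : (N%:R - 2) * (p - 1) = 4 - 2 * s by rewrite p1E; field; lra.
  nra.
rewrite -mulrA; apply: le_trans (ler_wpM2l _ (ler_pM _ _ h1 h2)) _.
- lra.
- exact: powR_ge0.
- by rewrite invr_ge0 powR_ge0.
rewrite /potential_bound.
set X := _ `^ _ in h3 *; set Y := _ `^ (- s) in h3 *.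
have -> : p * (C `^ (p - 1) * X * (((1 + l) / l) `^ s * Y)) =
  p * C `^ (p - 1) * ((1 + l) / l) `^ s * (X * Y) by ring.
by apply: ler_wpM2l h3; rewrite !mulr_ge0 ?powR_ge0//; lra.
Qed.

(** As [s - 4 = - 2 (a + 1) - 6 a], the left side gains a power [6 a] of [1 + r]
    on the right side. The condition [2 - s = 8 a] leaves this margin. *)
Lemma far_decay (a s K r : R) : 0 < a -> 0 <= K -> 2 - s = 8 * a -> 0 <= r ->
  (4 * K / a) `^ (6 * a)^-1 < 1 + r ->
  4 * (K * (1 + r) `^ (s - 4)) < a * (1 + r ^+ 2) `^ (- a - 1).
Proof.
move=> a0 K0 sa r0 rK.
have r1 : 0 < 1 + r by lra.
have h1 : 4 * K / a < (1 + r) `^ (6 * a).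
  have E0 : 0 <= 4 * K / a by rewrite divr_ge0 ?mulr_ge0//; lra.
  have -> : 4 * K / a = ((4 * K / a) `^ (6 * a)^-1) `^ (6 * a).
    by rewrite -powRrM mulVf ?powRr1//; lra.
  apply: gt0_ltr_powR => //; first lra.
    by rewrite nnegrE powR_ge0.
  by rewrite nnegrE ltW.
have h2 : (1 + r) `^ (- 2 * (a + 1)) <= (1 + r ^+ 2) `^ (- a - 1).
  have -> : - 2 * (a + 1) = 2 * (- a - 1) by ring.
  rewrite powRrM.
  have -> : - a - 1 = - (a + 1) by ring.
  have q0 : 0 <= r ^+ 2 by exact: sqr_ge0.
  rewrite !powRN lef_pV2 ?posrE ?powR_gt0//; last by lra.
  apply: ge0_ler_powR; rewrite ?nnegrE ?powR_ge0//; [lra|lra|].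
  rewrite -[2]/(2%:R) powR_mulrn; last exact: ltW.
  nra.
apply: lt_le_trans (ler_wpM2l (ltW a0) h2).
have -> : - 2 * (a + 1) = 6 * a + (s - 4) by lra.
rewrite (@powRD _ _ (6 * a)); last by rewrite (gt_eqF r1) implybT.
rewrite !mulrA ltr_pM2r ?powR_gt0//.
by rewrite [ltRHS]mulrC -ltr_pdivrMr.
Qed.

(** The power of [1 + dot x x] is superharmonic in dimension at least 3 and takes
    care of infinity; the two exponentials are strongly concave in thin strips
    along [x 0 ord0 = 0] and along [dot x e = l]. The constant 3 makes the barrier
    at least 1, so that no comparison of decay rates is needed at infinity, and
    the upper bound 4 does not depend on [k]; the radius beyond which the
    power dominates can therefore be chosen independently of the width [1 / k] of
    the strips. *)
Definition barrier (n : nat) (a k l : R) (e : 'rV[R]_n.+1) (x : 'rV[R]_n.+1) : R :=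
  3 + (1 + dot x x) `^ (- a) - expR (k * x 0 ord0) - expR (k * (l - dot x e)).

Lemma barrier_ge1 (n : nat) (a k l : R) (e x : 'rV[R]_n.+1) : 0 < k ->
  x 0 ord0 <= 0 -> l <= dot x e -> 1 <= barrier a k l e x.
Proof.
move=> k0 x0 xl; rewrite /barrier.
have h1 : expR (k * x 0 ord0) <= 1 by rewrite -expR0 ler_expR; nra.
have h2 : expR (k * (l - dot x e)) <= 1 by rewrite -expR0 ler_expR; nra.
have := powR_ge0 (1 + dot x x) (- a); lra.
Qed.

Lemma barrier_le4 (n : nat) (a k l : R) (e x : 'rV[R]_n.+1) : 0 <= a ->
  barrier a k l e x <= 4.
Proof.
move=> a0; rewrite /barrier.
have h1 := expR_ge0 (k * x 0 ord0).
have h2 := expR_ge0 (k * (l - dot x e)).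
have h3 : (1 + dot x x) `^ (- a) <= 1.
  rewrite -[leRHS](powRr0 (1 + dot x x)); apply: ler_powR; last by lra.
  by have := dot_ge0 x; lra.
lra.
Qed.

Lemma continuous_barrier (n : nat) (a k l : R) (e : 'rV[R]_n.+1) :
  continuous (barrier a k l e).
Proof.
move=> x.
have h1 : {for x, continuous (fun x : 'rV[R]_n.+1 => (1 + dot x x) `^ (- a))}.
  apply: (@continuous_comp _ _ _ (fun x => 1 + dot x x) (@powR R ^~ (- a))).
    exact: (cvgD (cvg_cst _) (@continuous_dot2 R n.+1 x)).
  have x0 : 0 < 1 + dot x x by have := dot_ge0 x; lra.
  by apply/differentiable_continuous/derivable1_diffP; case: (is_derive1_powR (- a) x0).
have h2 : {for x, continuous (fun x : 'rV[R]_n.+1 => expR (k * x 0 ord0))}.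
  apply: (@continuous_comp _ _ _ (fun x : 'rV[R]_n.+1 => k * x 0 ord0) (@expR R)).
    have xi := @coord_continuous R 1 n.+1 0 ord0 x; exact: (cvgMl_tmp xi).
  exact: continuous_expR.
have h3 : {for x, continuous (fun x : 'rV[R]_n.+1 => expR (k * (l - dot x e)))}.
  apply: (@continuous_comp _ _ _ (fun x : 'rV[R]_n.+1 => k * (l - dot x e)) (@expR R)).
    have xi := @continuous_dot R n.+1 e x.
    exact: (cvgMl_tmp (cvgB (cvg_cst l) xi)).
  exact: continuous_expR.
exact: (cvgB (cvgB (cvgD (cvg_cst _) h1) h2) h3).
Qed.

(** The condition [a <= 1 / 4] gives [2 n - 4 (a + 1) >= 1] for [n >= 3], which is
    the factor left in front of [a * (1 + |x|^2) ^ (- a - 1)]. *)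
Lemma barrier_superharmonic (n : nat) (a k l : R) (e x : 'rV[R]_n.+1) :
  (3 <= n.+1)%N -> 0 < a -> a <= 4^-1 -> dot e e = 1 ->
  exists2 L, hessian_trace (barrier a k l e) x L &
    L <= - (a * (1 + dot x x) `^ (- a - 1) + k ^+ 2 * expR (k * x 0 ord0)
            + k ^+ 2 * expR (k * (l - dot x e))).
Proof.
move=> n3 a0 a4 e1.
have f1 : dot (unit_vec R (@ord0 n)) (unit_vec R ord0) = 1.
  by rewrite dot_unit !mxE !eqxx.
have H := hessian_traceD (hessian_traceD (hessian_traceD
  (hessian_trace_cst x 3) (hessian_trace_powR x (- a)))
  (hessian_traceZ (-1) (hessian_trace_expR x (unit_vec R (@ord0 n)) k 0)))
  (hessian_traceZ (-1) (hessian_trace_expR x e (- k) (k * l))).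
eexists.
  rewrite (_ : barrier a k l e = cst 3 + (fun x => (1 + dot x x) `^ (- a)) +
     -1 *: (fun x => expR (0 + k * dot x (unit_vec R ord0))) +
     -1 *: (fun x => expR (k * l + - k * dot x e))); first exact: H.
  apply/funext => y; rewrite /barrier !fctE /GRing.scale/= !mulN1r dot_unit add0r.
  by congr (_ - expR _); ring.
rewrite f1 e1 dot_unit !add0r !mulN1r !mulr1 sqrrN mulNr -mulrBr.
have n3' : 3 <= n.+1%:R :> R by rewrite (ler_nat R 3 n.+1).
set c := 1 + dot x x.
have c0 : 0 < c by rewrite /c; have := dot_ge0 x; lra.
have -> : dot x x = c - 1 by rewrite /c; ring.
have -> : - a - 2 = - a - 1 - 1 by ring.
set q := - a - 1.
have cq : c `^ q = c * c `^ (q - 1).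
  rewrite -{2}(powRr1 (ltW c0)) -powRD ?(gt_eqF c0) ?implybT//.
  by congr (_ `^ _); ring.
have Q0 := powR_gt0 (q - 1) c0.
rewrite cq; set Q := c `^ (q - 1) in Q0 *.
have key : 4 * - a * q * (c - 1) * Q + 2 * n.+1%:R * - a * (c * Q) <= - (a * (c * Q)).
  rewrite -subr_ge0.
  have -> : - (a * (c * Q)) - (4 * - a * q * (c - 1) * Q + 2 * n.+1%:R * - a * (c * Q))
     = a * Q * (c * (2 * n.+1%:R - 5 - 4 * a) + 4 * (a + 1)) by rewrite /q; ring.
  apply: mulr_ge0; first by rewrite mulr_ge0// ltW.
  apply: addr_ge0; last by lra.
  apply: mulr_ge0; [exact: ltW|lra].
lra.
Qed.

End Estimates.

(** * Extension across the boundary *)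

Section HalfSpace.
Context {R : realType} {m : nat}.

Lemma continuous_coord0 : continuous (fun x : 'rV[R]_m.+1 => x 0 ord0).
Proof. exact: coord_continuous. Qed.

Lemma open_halfspace : open (halfspace R m).
Proof.
rewrite openE => x /= x0; rewrite /interior.
exact: (cvgr_lt _ (@continuous_coord0 x)).
Qed.

Lemma nbhs_halfspace (x : 'rV[R]_m.+1) : halfspace R m x ->
  \forall y \near x, halfspace R m y.
Proof. by move=> Hx; apply: open_nbhs_nbhs; split => //; exact: open_halfspace. Qed.

(** The projection onto the closed half-space. Composing with it turns continuity
    within the closed half-space into plain continuity ([continuous_ext]), which
    composes with reflections and survives in closed conditions. *)
Definition clamp (x : 'rV[R]_m.+1) : 'rV[R]_m.+1 :=
  x - Num.max (x 0 ord0) 0 *: unit_vec R ord0.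

Lemma clamp_closed x : closed_halfspace R m (clamp x).
Proof.
rewrite /closed_halfspace/= !mxE !eqxx mulr1 subr_le0 le_max lexx//.
Qed.

Lemma clamp_id x : closed_halfspace R m x -> clamp x = x.
Proof. by rewrite /closed_halfspace/clamp/= => x0; rewrite max_r// scale0r subr0. Qed.

Lemma continuous_clamp : continuous clamp.
Proof.
move=> x.
have h : {for x, continuous (fun x : 'rV[R]_m.+1 => Num.max (x 0 ord0) 0)}.
  apply: (@continuous_max R _ (fun x : 'rV[R]_m.+1 => x 0 ord0) (cst 0) x).
    exact: continuous_coord0.
  exact: cst_continuous.
exact: (cvgB cvg_id (cvgZr_tmp h)).
Qed.

Definition ext (u : 'rV[R]_m.+1 -> R) : 'rV[R]_m.+1 -> R := u \o clamp.

Lemma extE u x : closed_halfspace R m x -> ext u x = u x.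
Proof. by move=> Hx; rewrite /ext/= clamp_id. Qed.

Lemma continuous_ext u : {within closed_halfspace R m, continuous u} ->
  continuous (ext u).
Proof.
move=> /subspace_continuousP cu x.
have h : clamp y @[y --> x] --> within (closed_halfspace R m) (nbhs (clamp x)).
  move=> A nA.
  have nA' : \forall y \near x, closed_halfspace R m (clamp y) -> A (clamp y).
    exact: (@continuous_clamp x _ nA).
  have {}nA' : \forall y \near x, A (clamp y).
    by apply: filterS nA' => y; apply; exact: clamp_closed.
  exact: nA'.
exact: (@cvg_comp _ _ _ clamp u (nbhs x) _ _ h (cu _ (clamp_closed x))).
Qed.

End HalfSpace.

(** * Moving planes *)

Lemma closed_sublevel (R : realType) (T : topologicalType) (f : T -> R) (a : R) :
  continuous f -> closed [set x | f x <= a].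
Proof.
move=> cf; apply: (@closed_comp _ _ f [set y | y <= a]) => [x _|].
  exact: cf.
exact: closed_le.
Qed.

(** The arithmetic at a contact point, where [w = - mu * phi]; there [A] stands for
    the Laplacian of [w] and [L] for minus the Laplacian of [phi]. *)
Lemma contact_bound (R : realType) (A c mu phi L : R) : 0 < mu -> 0 <= c ->
  phi <= 4 -> - (c * (mu * phi)) <= A -> A <= mu * L -> - L <= 4 * c.
Proof.
move=> mu0 c0 phi4 h1 h2.
have h3 := ler_wpM2l (mulr_ge0 c0 (ltW mu0)) phi4.
by rewrite -(ler_pM2l mu0); lra.
Qed.

Section MovingPlanes.
Context {R : realType} {m : nat} (m3 : (3 <= m.+1)%N) (s : R) (s0 : 0 < s) (s2 : s < 2).
Context (u : 'rV[R]_m.+1 -> R) (uC2 : class_C 2 (halfspace R m) u)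
  (ucont : {within closed_halfspace R m, continuous u}).
Context (upde : forall x, halfspace R m x ->
    laplacian u x = (u x) `^ (crit_exp m.+1 s - 1) / (enorm x) `^ s).
Context (upos : forall x, halfspace R m x -> 0 < u x).
Context (ubnd : forall x : 'rV[R]_m.+1, x 0 ord0 = 0 -> u x = 0).
Context (C : R) (C0 : 0 < C).
Context (udecay : forall x, halfspace R m x ->
    u x <= C * (1 + enorm x) `^ (1 - (m.+1)%:R)).
Context (e : 'rV[R]_m.+1) (e1 : dot e e = 1) (e0 : e 0 ord0 = 0).

Let p : R := crit_exp m.+1 s - 1.

Definition cap (l : R) : set 'rV[R]_m.+1 := [set x | halfspace R m x /\ l < dot x e].

Definition violation (l : R) : Prop := exists2 x, cap l x & u (reflection e l x) < u x.

Lemma halfspace_reflection l x : halfspace R m (reflection e l x) = halfspace R m x.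
Proof. by rewrite /halfspace/= reflection_coord. Qed.

Lemma closed_halfspace_reflection l x : closed_halfspace R m (reflection e l x) = closed_halfspace R m x.
Proof. by rewrite /closed_halfspace/= reflection_coord. Qed.

Lemma halfspaceW (x : 'rV[R]_m.+1) : halfspace R m x -> closed_halfspace R m x.
Proof. exact: ltW. Qed.

Lemma u_ge0 x : closed_halfspace R m x -> 0 <= u x.
Proof.
rewrite /closed_halfspace/= le_eqVlt => /predU1P[/ubnd ->//|x0].
exact/ltW/upos.
Qed.

Lemma u_le_inv x : closed_halfspace R m x -> u x <= C / (1 + enorm x).
Proof.
have C0' := C0.
have x1 : 1 <= 1 + enorm x by have := enorm_ge0 x; lra.
rewrite /closed_halfspace/= le_eqVlt => /predU1P[/ubnd ->//|x0].
  by rewrite divr_ge0//; lra.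
apply: le_trans (udecay x0) _.
rewrite ler_pM2l// -powR_inv1; last by lra.
apply: ler_powR => //.
have : 3 <= m.+1%:R :> R by rewrite (ler_nat R 3 m.+1).
lra.
Qed.

Lemma continuous_reflection l : continuous (reflection e l).
Proof.
move=> x.
have h : {for x, continuous (fun x : 'rV[R]_m.+1 => 2 * (dot x e - l))}.
  exact: (cvgMl_tmp (cvgB (@continuous_dot R _ e x) (cvg_cst l))).
exact: (cvgB cvg_id (cvgZr_tmp h)).
Qed.

(** [x] minimizes [w / phi], where [w] is the difference between the reflected
    solution and the solution, and [- mu] is the minimal value. On the boundary of
    the cap [w] vanishes, and far away [w >= - u] is too small to compete; thus the
    minimum over a large compact piece of the closed cap is interior. *)
Lemma violation_touching (l : R) (phi : 'rV[R]_m.+1 -> R) :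
  continuous phi ->
  (forall x, closed_halfspace R m x -> l <= dot x e -> 1 <= phi x) ->
  violation l ->
  exists x mu, [/\ cap l x, 0 < mu, u (reflection e l x) - u x + mu * phi x = 0 &
    \forall y \near x, 0 <= u (reflection e l y) - u y + mu * phi y].
Proof.
move=> cphi phi1 [x0 [Hx0 lx0] badx0].
have phix0 : 0 < phi x0 by apply: lt_le_trans (phi1 _ (halfspaceW Hx0) (ltW lx0)).
pose q := (u x0 - u (reflection e l x0)) / phi x0.
have q0 : 0 < q by rewrite divr_gt0// subr_gt0.
(* Beyond this radius [u <= C / (1 + |x|) < q], while the minimum is at most [- q]. *)
pose r := Num.max (enorm x0) (C / q).
pose D := [set x | [/\ closed_halfspace R m x, l <= dot x e & enorm x <= r]].
pose G x := (ext u (reflection e l x) - ext u x) / phi x.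
have GE x : closed_halfspace R m x -> G x = (u (reflection e l x) - u x) / phi x.
  by move=> Hx; rewrite /G !extE// closed_halfspace_reflection.
have D0 : D x0 by split; [exact: halfspaceW|exact: ltW|rewrite le_max lexx].
have cE := continuous_ext ucont.
have cD : compact D.
  apply: bounded_closed_compact.
    have [M [Mreal MP]] := @bounded_enorm_le R m.+1 r.
    by exists M; split => // N MN x [_ _ xr]; exact: MP N MN x xr.
  have -> : D = [set x : 'rV[R]_m.+1 | x 0 ord0 <= 0] `&`
      ([set x : 'rV[R]_m.+1 | - dot x e <= - l] `&` [set x : 'rV[R]_m.+1 | enorm x <= r]).
    apply/seteqP; split => x; first by case=> ? ? ?; do 2?split => //=; rewrite lerN2.
    by case=> ? [/=]; rewrite lerN2.
  apply: closedI; first exact: closed_sublevel (@continuous_coord0 R m).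
  apply: closedI; last exact: closed_sublevel (@continuous_enorm R _).
  by apply: closed_sublevel => x; exact: (cvgN (@continuous_dot R _ e x)).
have cG : {within D, continuous G}.
  apply: continuous_in_subspaceT => x; rewrite inE => -[Hx lx _].
  have phix : phi x != 0 by rewrite gt_eqF//; apply: lt_le_trans (phi1 _ Hx lx).
  have h : {for x, continuous (fun x => ext u (reflection e l x))}.
    exact: (continuous_comp (@continuous_reflection l x) (cE _)).
  exact: (cvgM (cvgB h (cE x)) (cvgV phix (cphi x))).
have [x] := EVT_min_rV (ex_intro _ x0 D0) cD cG.
rewrite inE => -[Hx lx xr] xmin.
have Gx : G x <= - q.
  apply: le_trans (xmin x0 _) _; first by rewrite inE.
  by rewrite (GE _ (halfspaceW Hx0)) /q -mulNr opprB.
have phix : 1 <= phi x by exact: phi1.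
have Gne : G x != 0 by rewrite lt_eqF//; lra.
have Hx' : halfspace R m x.
  rewrite /halfspace/= lt_neqAle [_ <= _]Hx andbT; apply: contra_neq Gne => x00.
  by rewrite GE// !ubnd ?reflection_coord// subrr mul0r.
have lx' : l < dot x e.
  rewrite lt_neqAle lx andbT; apply: contra_neq Gne => lE.
  by rewrite GE// lE reflection_fixed subrr mul0r.
have Gx' : - u x <= G x * phi x.
  rewrite GE// mulfVK; last by rewrite gt_eqF//; lra.
  have := @u_ge0 (reflection e l x); rewrite closed_halfspace_reflection => /(_ Hx); lra.
have xr' : enorm x < r.
  rewrite ltNge; apply/negP => rx.
  have ux := u_le_inv Hx.
  have Cq : C / q <= enorm x by apply: le_trans rx; rewrite le_max lexx orbT.
  have : u x < q.
    apply: le_lt_trans ux _.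
    rewrite ltr_pdivrMr; last by have := enorm_ge0 x; lra.
    by move: Cq; rewrite ler_pdivrMr//; lra.
  nra.
exists x, (- G x); split => //; first by lra.
  by rewrite GE// mulNr mulfVK ?subrr// gt_eqF//; lra.
have n1 : \forall y \near x, halfspace R m y by exact: nbhs_halfspace.
have n2 : \forall y \near x, l < dot y e := cvgr_gt _ (@continuous_dot R _ e x) _ lx'.
have n3 : \forall y \near x, enorm y < r := cvgr_lt _ (@continuous_enorm R _ x) _ xr'.
near=> y.
have Hy : halfspace R m y by near: y; exact: n1.
have ly : l < dot y e by near: y; exact: n2.
have yr : enorm y < r by near: y; exact: n3.
have := xmin y; rewrite inE => /(_ (And3 (halfspaceW Hy) (ltW ly) (ltW yr))).
have phiy : 1 <= phi y by apply: phi1; [exact: halfspaceW|exact: ltW].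
rewrite (GE _ (halfspaceW Hy)) ler_pdivlMr; last by lra.
lra.
Unshelve. all: by end_near. Qed.

(** The second derivative test at a minimum of [w + mu * phi], summed over the
    coordinate directions. *)
Lemma touching_laplacian (l mu L : R) (phi : 'rV[R]_m.+1 -> R) (x : 'rV[R]_m.+1) :
  halfspace R m x -> hessian_trace phi x L ->
  u (reflection e l x) - u x + mu * phi x = 0 ->
  (\forall y \near x, 0 <= u (reflection e l y) - u y + mu * phi y) ->
  laplacian u (reflection e l x) - laplacian u x <= mu * L.
Proof.
move=> Hx Hphi Ex minx.
have Hrx : halfspace R m (reflection e l x) by rewrite halfspace_reflection.
have oH := @open_halfspace R m.
have T := hessian_traceD (hessian_traceD (hessian_trace_reflection oH e1 Hrx uC2)
  (hessian_traceZ (-1) (hessian_trace_laplacian oH Hx uC2))) (hessian_traceZ mu Hphi).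
suff /(hessian_trace_min T) : \forall y \near x,
    (u \o reflection e l + -1 *: u + mu *: phi) x <= (u \o reflection e l + -1 *: u + mu *: phi) y.
  by move: (laplacian u (reflection e l x)) (laplacian u x) => A B; rewrite mulN1r opprK; lra.
by apply: filterS minx => y; rewrite !fctE /GRing.scale/= !mulN1r Ex.
Qed.

Lemma enorm_reflection_lt (l : R) (x : 'rV[R]_m.+1) : 0 < l -> cap l x ->
  0 < enorm (reflection e l x) /\ enorm (reflection e l x) < enorm x.
Proof.
move=> l0 [Hx lx]; split.
  apply: enorm_gt0; apply/eqP => rx0.
  have : halfspace R m (reflection e l x) by rewrite halfspace_reflection.
  by rewrite /halfspace/= rx0 mxE ltxx.
rewrite -ltr_sqr ?nnegrE ?enorm_ge0// !enorm_sqr dot_reflection//.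
have : 0 < l * (dot x e - l) by rewrite mulr_gt0// subr_gt0.
lra.
Qed.

(** At an interior zero of [w >= 0] the Laplacian of [w] is nonpositive, but the
    equation makes it positive because the reflection strictly decreases the
    norm. This replaces the strong maximum principle. *)
Lemma no_contact (l : R) (x : 'rV[R]_m.+1) : 0 < l -> cap l x ->
  (forall y, cap l y -> u y <= u (reflection e l y)) -> u (reflection e l x) = u x -> False.
Proof.
move=> l0 cx good ux.
have [Hx lx] := cx.
have Hrx : halfspace R m (reflection e l x) by rewrite halfspace_reflection.
have [r0 rx] := enorm_reflection_lt l0 cx.
have minx : \forall y \near x, 0 <= u (reflection e l y) - u y + 0 * 0.
  have n1 : \forall y \near x, halfspace R m y := nbhs_halfspace Hx.
  have n2 : \forall y \near x, l < dot y e.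
    exact: (cvgr_gt _ (@continuous_dot R _ e x) _ lx).
  near=> y.
  have cy : cap l y by split; near: y; [exact: n1|exact: n2].
  by rewrite mul0r addr0 subr_ge0 good.
have Ex : u (reflection e l x) - u x + 0 * 0 = 0 by rewrite ux subrr mul0r addr0.
have := @touching_laplacian l 0 0 (cst 0) x Hx (hessian_trace_cst x 0) Ex minx.
rewrite mul0r; apply/negP; rewrite -ltNge.
rewrite !upde// ux -mulrBr mulr_gt0 ?powR_gt0 ?upos// subr_gt0.
rewrite ltf_pV2 ?posrE ?powR_gt0//; last exact: lt_trans rx.
by apply: gt0_ltr_powR; rewrite ?nnegrE// ?enorm_ge0.
Unshelve. all: by end_near. Qed.

Lemma crit_exp_sub1_gt1 : 1 < p.
Proof.
have s0' := s0; have s2' := s2.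
have h : 3 <= m.+1%:R :> R by rewrite (ler_nat R 3 m.+1).
rewrite /p /crit_exp.
have -> : 2 * (m.+1%:R - s) / (m.+1%:R - 2) - 1 = 1 + (4 - 2 * s) / (m.+1%:R - 2).
  by field; lra.
by rewrite ltrDl divr_gt0//; lra.
Qed.

(** Since the reflection decreases the norm, the weight at [x] may be used for
    both terms; convexity of the power then gives the linear bound. *)
Lemma laplacian_reflection_ge (l : R) (x : 'rV[R]_m.+1) : 0 < l -> cap l x ->
  u (reflection e l x) < u x ->
  - (p * u x `^ (p - 1) / enorm x `^ s) * (u x - u (reflection e l x)) <=
    laplacian u (reflection e l x) - laplacian u x.
Proof.
move=> l0 cx ux.
have [Hx lx] := cx.
have Hrx : halfspace R m (reflection e l x) by rewrite halfspace_reflection.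
have [r0 rx] := enorm_reflection_lt l0 cx.
rewrite !upde// -/p.
have h1 := powR_tangent (ltW crit_exp_sub1_gt1) (upos Hrx) ux.
have ex0 : 0 < enorm x `^ s by rewrite powR_gt0// (lt_trans r0).
have h2 : (enorm x `^ s)^-1 <= (enorm (reflection e l x) `^ s)^-1.
  rewrite lef_pV2 ?posrE ?powR_gt0 ?(lt_trans r0 rx)//.
  by apply: ge0_ler_powR; rewrite ?nnegrE ?enorm_ge0// ltW.
have h3 := ler_wpM2l (powR_ge0 (u (reflection e l x)) p) h2.
have ei0 : 0 <= (enorm x `^ s)^-1 by rewrite invr_ge0 ltW.
have h4 := ler_wpM2r ei0 h1.
move: h3 h4; rewrite mulrBl.
set X := (enorm x `^ s)^-1; set Y := (enorm _ `^ s)^-1.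
set U := u x `^ p; set V := u _ `^ p; set W := u x `^ (p - 1).
by move=> h3 h4; lra.
Qed.

(** At the contact point with the barrier the Laplacian of the barrier is at most
    [4 c]. This fails in the strips of width [1 / k] and outside the ball of radius
    [r], so the contact point is in neither. *)
Lemma violation_confined (l0 : R) : 0 < l0 -> exists k r : R, 0 < k /\
  forall l, l0 <= l -> violation l -> exists x, [/\ cap l x, u (reflection e l x) < u x,
    x 0 ord0 <= - k^-1, l + k^-1 <= dot x e & enorm x <= r].
Proof.
have s0' := s0; have s2' := s2; have C0' := C0.
move=> l00.
pose K := potential_bound p C l0 s.
have p1 := crit_exp_sub1_gt1.
have K0 : 0 <= K.
  by rewrite /K /potential_bound !mulr_ge0 ?powR_ge0//; lra.
(* The exponent for which [far_decay] applies; it is below 1/4 as [s > 0]. *)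
pose a := (2 - s) / 8.
have a0 : 0 < a by rewrite /a; lra.
have a4 : a <= 4^-1 by rewrite /a; lra.
have E1 : 1 <= expR 1 :> R by rewrite -[leLHS]expR0 ler_expR.
(* In the strips the exponentials are at least [expR (- 1)], so [k] must satisfy
   [k ^+ 2 * expR (- 1) > 4 * K], where [K] bounds [c]. *)
pose k := 4 * K * expR 1 + 1.
have K4 : 0 <= 4 * K by lra.
have k1 : 1 <= k by rewrite /k lerDr mulr_ge0 ?expR_ge0.
have k0 : 0 < k by lra.
have kK (t : R) : - 1 <= t -> 4 * K < k ^+ 2 * expR t.
  move=> t1.
  have h1 : expR (- 1) <= expR t by rewrite ler_expR.
  have h2 : expR (- 1) * expR 1 = 1 :> R by rewrite -expRD addNr expR0.
  have h3 : 0 < expR (- 1) :> R by exact: expR_gt0.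
  have h4 : 4 * K < k * expR (- 1).
    have -> : k * expR (- 1) = 4 * K * (expR (- 1) * expR 1) + expR (- 1).
      by rewrite /k; ring.
    by rewrite h2 mulr1 ltrDl.
  have k2 : k <= k ^+ 2 by rewrite expr2 ler_peMr// ltW.
  exact: lt_le_trans h4 (ler_pM (ltW k0) (ltW h3) k2 h1).
exists k, ((4 * K / a) `^ (6 * a)^-1); split => // l l0l badl.
have l0' : 0 < l by lra.
have [x [mu [cx mu0 Ex minx]]] := violation_touching (@continuous_barrier R m a k l e)
  (fun x => @barrier_ge1 R m a k l e x k0) badl.
have [Hx lx] := cx.
have phi1 := @barrier_ge1 R m a k l e x k0 (halfspaceW Hx) (ltW lx).
have phi4 := @barrier_le4 R m a k l e x (ltW a0).
have ux : u (reflection e l x) < u x by have := mulr_gt0 mu0 (lt_le_trans ltr01 phi1); lra.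
have [L HL Lle] := @barrier_superharmonic R m a k l e x m3 a0 a4 e1.
have h1 := touching_laplacian Hx HL Ex minx.
have h2 := laplacian_reflection_ge l0' cx ux.
set c := p * _ / _ in h2.
have c0 : 0 <= c.
  exact: divr_ge0 (mulr_ge0 (ltW (lt_trans ltr01 p1)) (powR_ge0 _ _)) (powR_ge0 _ _).
have h3 : - L <= 4 * c.
  have Ed : u x - u (reflection e l x) = mu * barrier a k l e x.
    by apply/eqP; rewrite eq_sym -subr_eq0 opprB addrC Ex.
  rewrite Ed mulNr in h2; exact: contact_bound mu0 c0 phi4 h2 h1.
clear h2 h1 Ex minx.
have xe := dot_le_enorm x e1.
have ex0 := enorm_ge0 x.
have h4 : c <= K * (1 + enorm x) `^ (s - 4).
  have lx0 : l0 <= enorm x := le_trans l0l (le_trans (ltW lx) xe).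
  exact: (potential_decay m3 erefl s0 s2 C0 l00 lx0 (upos Hx) (udecay Hx)).
clearbody c.
have h5 : c <= K.
  apply: le_trans h4 _; rewrite -[leRHS]mulr1; apply: ler_wpM2l => //.
  by rewrite -[leRHS](powRr0 (1 + enorm x)); apply: ler_powR; lra.
set S1 := a * _ in Lle; set S2 := k ^+ 2 * _ in Lle; set S3 := k ^+ 2 * _ in Lle.
have S10 : 0 <= S1 by rewrite mulr_ge0 ?powR_ge0// ltW.
have S20 : 0 <= S2 by rewrite mulr_ge0 ?expR_ge0// sqr_ge0.
have S30 : 0 <= S3 by rewrite mulr_ge0 ?expR_ge0// sqr_ge0.
have kinv (t : R) : - k^-1 < t -> - 1 <= k * t.
  by rewrite -(ltr_pM2l k0) mulrN divff ?gt_eqF// => /ltW.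
exists x; split => //.
- rewrite leNgt; apply/negP => xk.
  have : 4 * K < S2.
    by apply/kK/kinv.
  lra.
- rewrite leNgt; apply/negP => xk.
  have : 4 * K < S3 by apply/kK/kinv; lra.
  lra.
- rewrite leNgt; apply/negP => xr.
  have : 4 * (K * (1 + enorm x) `^ (s - 4)) < S1.
    rewrite /S1 -enorm_sqr; apply: far_decay => //; [by rewrite /a; lra|lra].
  lra.
Qed.

Lemma continuous_reflection_pair : continuous (fun q : R * 'rV[R]_m.+1 => reflection e q.1 q.2).
Proof.
move=> q.
have h1 : {for q, continuous (fun q : R * 'rV[R]_m.+1 => q.1)} by exact: cvg_fst.
have h2 : {for q, continuous (fun q : R * 'rV[R]_m.+1 => q.2)} by exact: cvg_snd.
have h3 : {for q, continuous (fun q : R * 'rV[R]_m.+1 => dot q.2 e)}.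
  exact: (continuous_comp h2 (@continuous_dot R _ e q.2)).
have h : {for q, continuous (fun q : R * 'rV[R]_m.+1 => 2 * (dot q.2 e - q.1))}.
  exact: (cvgMl_tmp (cvgB h3 h1)).
exact: (cvgB h2 (cvgZr_tmp h)).
Qed.

Lemma no_violation_le l : ~ violation l -> forall y, cap l y -> u y <= u (reflection e l y).
Proof.
move=> nb y cy; rewrite leNgt; apply/negP => uy; apply: nb.
by exists y.
Qed.

(** A violation is an open condition on the position of the plane. *)
Lemma no_violation_limit l : (forall l', l < l' -> ~ violation l') -> ~ violation l.
Proof.
move=> nb [y [Hy ly] uy].
have cE := continuous_ext ucont.
have c1 : {for l, continuous (fun l => ext u (reflection e l y))}.
  have h : {for l, continuous (fun l : R => (l, y))}.
    exact: (cvg_pair cvg_id (cvg_cst y)).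
  exact: (continuous_comp (continuous_comp h (@continuous_reflection_pair (l, y))) (cE _)).
have uy' : ext u (reflection e l y) < u y.
  by rewrite extE ?closed_halfspace_reflection//; exact: ltW.
have n1 : \forall l' \near l, ext u (reflection e l' y) < u y := cvgr_lt _ c1 _ uy'.
have n2 : \forall l' \near l, l' < dot y e := lt_nbhsl ly.
have n3 : \forall l' \near l^'+, l < l' := nbhs_right_gt l.
near l^'+ => l'.
apply: (nb l').
  by near: l'; exact: n3.
exists y.
  split => //; near: l'; apply: cvg_within; exact: n2.
rewrite -[ltLHS]extE ?closed_halfspace_reflection//; last exact: ltW.
near: l'; apply: cvg_within; exact: n1.
Unshelve. all: by end_near. Qed.

(** The set [A] below collects the pairs (plane, point) at which the comparison is
    not strict, with the point in the compact region given by
    [violation_confined]. The pair with the farthest plane would be an interior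
    zero of [w >= 0], against [no_contact]. *)
Theorem moving_planes l0 : 0 < l0 -> ~ violation l0.
Proof.
move=> l00 bad0.
have [k [r [k0 confined]]] := violation_confined l00.
have cE := continuous_ext ucont.
pose T : Type := (R * 'rV[R]_m.+1)%type.
pose A := [set q : T | [/\ l0 <= q.1, q.1 <= r & enorm q.2 <= r] /\
  [/\ q.2 0 ord0 <= - k^-1, q.1 + k^-1 <= dot q.2 e &
      ext u (reflection e q.1 q.2) <= ext u q.2]].
have inA l : l0 <= l -> violation l -> exists x, A (l, x).
  move=> l0l /(confined l l0l) [x [[Hx lx] ux xk lk xr]]; exists x; split; split => //=.
    exact: le_trans (ltW lx) (le_trans (dot_le_enorm x e1) xr).
  by rewrite !extE ?closed_halfspace_reflection//; exact: ltW.
have f1 : continuous (fun q : T => q.1) by move=> q; exact: cvg_fst.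
have f2 : continuous (fun q : T => q.2) by move=> q; exact: cvg_snd.
have f2' (f : 'rV[R]_m.+1 -> R) : continuous f -> continuous (fun q : T => f q.2).
  by move=> cf q; exact: (continuous_comp (f2 q) (cf _)).
have cA : compact A.
  apply: (@subclosed_compact _ _ (`[l0, r]%classic `*` [set x | enorm x <= r])).
  - have -> : A = [set q : T | - q.1 <= - l0] `&` ([set q : T | q.1 <= r] `&`
      ([set q : T | enorm q.2 <= r] `&` ([set q : T | q.2 0 ord0 <= - k^-1] `&`
      ([set q : T | q.1 - dot q.2 e <= - k^-1] `&`
       [set q : T | ext u (reflection e q.1 q.2) - ext u q.2 <= 0])))).
      apply/seteqP; split => q /=; rewrite lerN2 subr_le0.
        by move=> [[? ? ?] [? ? ?]]; do !split => //; lra.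
      by move=> [? [? [? [? [? ?]]]]]; split; split => //; lra.
    apply: closedI; first by apply: closed_sublevel => q; exact: (cvgN (f1 q)).
    apply: closedI; first exact: closed_sublevel f1.
    apply: closedI; first exact: closed_sublevel (f2' _ (@continuous_enorm R _)).
    apply: closedI; first exact: closed_sublevel (f2' _ (@continuous_coord0 R m)).
    apply: closedI; apply: closed_sublevel => q.
      exact: (cvgB (f1 q) (f2' _ (@continuous_dot R _ e) q)).
    exact: (cvgB (continuous_comp (@continuous_reflection_pair q) (cE _)) (f2' _ cE q)).
  - apply: compact_setX; first exact: segment_compact.
    apply: bounded_closed_compact; first exact: bounded_enorm_le.
    exact: closed_sublevel (@continuous_enorm R _).
  - by move=> q [[h1 h2 h3] _]; split => //=; rewrite in_itv/= h1 h2.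
have A0 : A !=set0 by have [x Ax] := inA l0 (lexx _) bad0; exists (l0, x).
have [q] := compact_EVT_max A0 cA (continuous_subspaceT f1).
rewrite inE => -[[l0l lr xr] [xk lk ux]] qmax.
have nb : ~ violation q.1.
  apply: no_violation_limit => l' ll' badl'.
  have [x Ax] := inA l' (le_trans l0l (ltW ll')) badl'.
  have := qmax (l', x); rewrite inE => /(_ Ax) /=; lra.
have ki0 : 0 < k^-1 by rewrite invr_gt0.
have Hx : halfspace R m q.2 by rewrite /halfspace/=; lra.
have cx : cap q.1 q.2 by split => //; lra.
apply: (@no_contact q.1 q.2) => //.
- lra.
- exact: no_violation_le nb.
apply/eqP; rewrite eq_le (no_violation_le nb cx) andbT.
by move: ux; rewrite !extE ?closed_halfspace_reflection//; exact: ltW.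
Qed.

End MovingPlanes.

(** * Isometries *)

Section Symmetry.
Context {R : realType} {m : nat}.

(** [e] is the normalized difference [x - y]. *)
Lemma exists_reflection (x y : 'rV[R]_m.+1) : x <> y -> dot x x = dot y y ->
  x 0 ord0 = y 0 ord0 ->
  exists e : 'rV[R]_m.+1, [/\ dot e e = 1, e 0 ord0 = 0, 0 < dot x e & reflection e 0 x = y].
Proof.
move=> xy dxy xy0.
have d0 : 0 < dot (x - y) (x - y).
  rewrite lt_neqAle dot_ge0 andbT eq_sym; apply/eqP => /dot_eq0 /eqP.
  by rewrite subr_eq0 => /eqP.
pose c := (Num.sqrt (dot (x - y) (x - y)))^-1.
have c0 : 0 < c by rewrite invr_gt0 sqrtr_gt0.
have c2 : c * c * dot (x - y) (x - y) = 1.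
  rewrite -expr2 exprVn sqr_sqrtr; last exact: ltW.
  by rewrite mulVf// gt_eqF.
have dx : dot x (x - y) = dot (x - y) (x - y) / 2.
  by rewrite !dotE dxy [dot y x]dotC; lra.
exists (c *: (x - y)); split.
- by rewrite dotZl dotZr mulrA.
- by rewrite !mxE xy0 subrr mulr0.
- by rewrite dotZr dx mulr_gt0// divr_gt0.
- rewrite /reflection subr0 scalerA dotZr dx.
  have -> : 2 * (c * (dot (x - y) (x - y) / 2)) * c = 1 by rewrite -[RHS]c2; field.
  by rewrite scale1r opprB addrCA subrr addr0.
Qed.

Lemma isometry_dot (sigma : 'rV[R]_m.+1 -> 'rV[R]_m.+1) :
  eisometry sigma -> sigma 0 = 0 -> forall x y, dot (sigma x) (sigma y) = dot x y.
Proof.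
move=> iso sigma0 x y.
have nrm z : dot (sigma z) (sigma z) = dot z z.
  by have := iso z 0; rewrite sigma0 !subr0 -!enorm_sqr => ->.
have := iso x y => /(congr1 (fun t => t ^+ 2)); rewrite !enorm_sqr !dotE !nrm.
by rewrite [dot y x]dotC [dot (sigma y) (sigma x)]dotC; lra.
Qed.

(** The image [b] of the inner unit normal [- f] has positive scalar product with
    every point of the half-space, as these are images of points of the
    half-space. Were [b] not parallel to [f], a small perturbation of minus its
    tangential part would be a point that contradicts this. *)
Lemma isometry_coord0 (sigma : 'rV[R]_m.+1 -> 'rV[R]_m.+1) :
  eisometry sigma -> sigma @` (halfspace R m) = halfspace R m -> sigma 0 = 0 ->
  forall x, sigma x 0 ord0 = x 0 ord0.
Proof.
move=> iso im sigma0 x.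
have sdot := isometry_dot iso sigma0.
pose f := unit_vec R (@ord0 m).
have f0 : f 0 ord0 = 1 by rewrite !mxE !eqxx.
have dotf y : dot y f = y 0 ord0 by exact: dot_unit.
have f1 : dot f f = 1 by rewrite dotf f0.
clearbody f.
pose b := sigma (- f).
have b1 : dot b b = 1 by rewrite sdot !dotE f1 opprK.
have Hb : halfspace R m b.
  rewrite -im; exists (- f) => //; rewrite /halfspace/= mxE f0; lra.
have pos y : halfspace R m y -> 0 < dot y b.
  rewrite -[X in X y -> _]im => -[z Hz <-].
  by rewrite sdot dotNr dotf oppr_gt0.
have b0 : b 0 ord0 < 0 := Hb.
have fb : dot f b = b 0 ord0 by rewrite dotC dotf.
have b01 : b 0 ord0 ^+ 2 = 1.
  apply/eqP; rewrite eq_le; apply/andP; split.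
    have := dot_ge0 (b - b 0 ord0 *: f); rewrite !dotE f1 b1 fb dotf; lra.
  rewrite leNgt; apply/negP => lt1.
(* With this [t] the scalar product of [b] with the point [y] below is
   [- (1 - b 0 ord0 ^+ 2) / 2]. *)
  pose t := (1 - b 0 ord0 ^+ 2) / (2 * - b 0 ord0).
  have bN : 0 < 2 * - b 0 ord0 by lra.
  have t0 : 0 < t by rewrite divr_gt0// subr_gt0.
  have tE : t * (2 * - b 0 ord0) = 1 - b 0 ord0 ^+ 2 by rewrite mulfVK// gt_eqF.
  pose y := - (b - b 0 ord0 *: f) - t *: f.
  have : halfspace R m y.
    rewrite /halfspace/= /y !mxE f0; lra.
  move=> /pos; rewrite /y !dotE b1 fb; nra.
have b0E : b 0 ord0 = -1 by nra.
have bf : b = - f.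
  apply/eqP; rewrite -subr_eq0 opprK; apply/eqP/dot_eq0.
  by rewrite !dotE b1 f1 fb dotf b0E; lra.
have := sdot x (- f); rewrite -/b bf !dotNr !dotf; lra.
Qed.

End Symmetry.

(** * The meridian half-plane *)

Section PlaneEmbedding.
Context {R : realType} {m : nat} (m2 : (2 <= m.+1)%N).

(** The plane spanned by the first two axes; the profile [v] of a symmetric
    function is its restriction to this plane. *)
Definition emb (y : 'rV[R]_2) : 'rV[R]_m.+1 :=
  \sum_i y 0 i *: unit_vec R (widen_ord m2 i).

Lemma embE y j : emb y 0 j = \sum_(i < 2) y 0 i * (j == widen_ord m2 i)%:R.
Proof. by rewrite summxE; apply: eq_bigr => i _; rewrite !mxE eqxx. Qed.

Lemma emb0 y : emb y 0 ord0 = y 0 ord0.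
Proof.
by rewrite embE big_ord_recl big_ord1 -!val_eqE/= mulr1 mulr0 addr0.
Qed.

Lemma emb_dot y : dot (emb y) (emb y) = y 0 ord0 ^+ 2 + y 0 (lift ord0 ord0) ^+ 2.
Proof.
rewrite /emb big_ord_recl big_ord1 !dotE !dot_unit !mxE !eqxx -!val_eqE/=; ring.
Qed.

Lemma emb_line h i y : emb (h *: unit_vec R i + y) = h *: unit_vec R (widen_ord m2 i) + emb y.
Proof.
rewrite /emb.
under eq_bigr do rewrite mxE scalerDl.
rewrite big_split/=; congr (_ + _).
rewrite (bigD1 i)//= big1 ?addr0 ?mxE ?eqxx ?mulr1//.
by move=> j ji; rewrite !mxE (negbTE ji) andbF mulr0 scale0r.
Qed.

Lemma continuous_emb : continuous emb.
Proof.
apply: continuous_big => [|i _ y]; first exact: add_continuous.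
exact: (cvgZr_tmp (@coord_continuous R 1 2 0 i y)).
Qed.

Lemma continuous_within_emb (A : set 'rV[R]_m.+1) (B : set 'rV[R]_2)
    (f : 'rV[R]_m.+1 -> R) : (forall y, B y -> A (emb y)) ->
  {within A, continuous f} -> {within B, continuous (f \o emb)}.
Proof.
move=> BA /subspace_continuousP cf; apply/subspace_continuousP => y By.
have h : emb z @[z --> within B (nbhs y)] --> within A (nbhs (emb y)).
  move=> U nU.
  have nU' : \forall z \near y, A (emb z) -> U (emb z) by exact: (@continuous_emb y _ nU).
  have nU2 : \forall z \near y, B z -> U (emb z).
    near=> z => /BA; near: z; exact: nU'.
  exact: nU2.
exact: (@cvg_comp _ _ _ emb f (within B (nbhs y)) _ _ h (cf _ (BA _ By))).
Unshelve. all: by end_near. Qed.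

Lemma quotient_emb (f : 'rV[R]_m.+1 -> R) i y :
  (fun h => h^-1 *: (f (emb (h *: unit_vec R i + y)) - f (emb y))) =
  (fun h => h^-1 *: (f (h *: unit_vec R (widen_ord m2 i) + emb y) - f (emb y))).
Proof. by apply/funext => h; rewrite emb_line. Qed.

Lemma partial_emb (f : 'rV[R]_m.+1 -> R) i :
  partial i (f \o emb) = partial (widen_ord m2 i) f \o emb.
Proof.
apply/funext => y.
exact: (congr1 (fun g : R -> R => lim (g @ (0 : R)^')) (quotient_emb f i y)).
Qed.

Lemma derivable_emb (f : 'rV[R]_m.+1 -> R) i y :
  derivable f (emb y) (unit_vec R (widen_ord m2 i)) ->
  derivable (f \o emb) y (unit_vec R i).
Proof.
move=> df.
have : cvg ((fun h => h^-1 *: (f (emb (h *: unit_vec R i + y)) - f (emb y))) @ (0 : R)^').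
  by rewrite quotient_emb.
by [].
Qed.

Lemma class_C_emb k (A : set 'rV[R]_m.+1) (B : set 'rV[R]_2) (f : 'rV[R]_m.+1 -> R) :
  (forall y, B y -> A (emb y)) -> class_C k A f -> class_C k B (f \o emb).
Proof.
move=> BA; elim: k f => [|k IH] f [cf df]; split.
- exact: continuous_within_emb cf.
- by [].
- exact: continuous_within_emb cf.
move=> i; have [di ci] := df (widen_ord m2 i); split.
  by move=> y By; apply: derivable_emb; exact/di/BA.
by rewrite partial_emb; exact: IH.
Qed.

Lemma C1_closed_halfspace_emb (f : 'rV[R]_m.+1 -> R) :
  C1_closed_halfspace f -> C1_closed_halfspace (f \o emb).
Proof.
have HH y : halfspace R 1 y -> halfspace R m (emb y) by rewrite /halfspace/= emb0.
have HHc y : closed_halfspace R 1 y -> closed_halfspace R m (emb y).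
  by rewrite /closed_halfspace/= emb0.
move=> [f1 fc fg]; split.
- exact: class_C_emb f1.
- exact: continuous_within_emb fc.
move=> i; have [g [gc gE]] := fg (widen_ord m2 i).
exists (g \o emb); split; first exact: continuous_within_emb gc.
by move=> y /HH /gE E; rewrite partial_emb /= E.
Qed.

End PlaneEmbedding.

Lemma consr0 (R : realType) (n : nat) (a : R) (x : 'rV[R]_n) : consr a x 0 ord0 = a.
Proof.
have E : ord0 = lshift n (@ord0 0) by apply: val_inj.
transitivity (row_mx (a%:M : 'M[R]_1) x 0 (lshift n (@ord0 0))); first by rewrite -E.
by rewrite row_mxEl mxE eqxx mulr1n.
Qed.

Lemma consr_lift (R : realType) (n : nat) (a : R) (x : 'rV[R]_n) (i : 'I_n) :
  consr a x 0 (lift ord0 i) = x 0 i.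
Proof.
have E : lift ord0 i = rshift 1 i by apply: val_inj.
transitivity (row_mx (a%:M : 'M[R]_1) x 0 (rshift 1 i)); last by rewrite row_mxEr.
by rewrite -E.
Qed.

Lemma consr_dot (R : realType) (n : nat) (a : R) (x : 'rV[R]_n) :
  dot (consr a x) (consr a x) = a ^+ 2 + dot x x.
Proof.
rewrite /dot big_ord_recl consr0 expr2; congr (_ + _).
by apply: eq_bigr => i _; rewrite consr_lift.
Qed.

(** * Symmetry of the solution *)

(* The dimension is n = m.+1. *)
Theorem theorem1p2 (R : realType) (m : nat) (hn : (3 <= m.+1)%N)
  (s : R) (hs0 : 0 < s) (hs2 : s < 2)
  (u : 'rV[R]_m.+1 -> R)
  (uC2 : class_C 2 (halfspace R m) u)
  (uC1 : C1_closed_halfspace u)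
  (upde : forall x, halfspace R m x ->
    laplacian u x = (u x) `^ (crit_exp m.+1 s - 1) / (enorm x) `^ s)
  (upos : forall x, halfspace R m x -> 0 < u x)
  (ubnd : forall x : 'rV[R]_m.+1, x 0 ord0 = 0 -> u x = 0)
  (udecay : exists C : R, 0 < C /\
    forall x, halfspace R m x -> u x <= C * (1 + enorm x) `^ (1 - (m.+1)%:R)) :
  (forall sigma : 'rV[R]_m.+1 -> 'rV[R]_m.+1,
     eisometry sigma ->
     sigma @` (halfspace R m) = halfspace R m ->
     sigma 0 = 0 ->
     forall x, closed_halfspace R m x -> u (sigma x) = u x) /\
  (exists v : 'rV[R]_2 -> R,
     [/\ class_C 2 (halfspace R 1) v,
         C1_closed_halfspace v &
         forall (x1 : R) (x' : 'rV[R]_m), x1 < 0 ->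
           u (consr x1 x') = v (consr x1 (\row_(_ < 1) enorm x'))]).
Proof.
have [C [C0 uC]] := udecay.
have [_ ucont _] := uC1.
have le_sphere (x y : 'rV[R]_m.+1) : halfspace R m x -> x 0 ord0 = y 0 ord0 -> dot x x = dot y y ->
    u x <= u y.
  move=> Hx xy0 dxy.
  have [->//|xy] := pselect (x = y).
  have [e [e1 e0 xe <-]] := exists_reflection xy dxy xy0.
  have nb l : 0 < l -> ~ violation u e l.
    by apply: (@moving_planes R m hn s hs0 hs2 u uC2 ucont upde upos ubnd C C0 uC).
  have nb0 := no_violation_limit ucont e0 nb.
  exact: no_violation_le nb0 _ (conj Hx xe).
have eq_sphere (x y : 'rV[R]_m.+1) : halfspace R m x -> x 0 ord0 = y 0 ord0 -> dot x x = dot y y ->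
    u x = u y.
  move=> Hx xy0 dxy; apply/eqP; rewrite eq_le !le_sphere//.
  by rewrite /halfspace/= -xy0.
split.
  move=> sigma iso im sigma0 x.
  have sx0 := isometry_coord0 iso im sigma0 x.
  rewrite /closed_halfspace/= le_eqVlt => /predU1P[x0|Hx].
    by rewrite !ubnd ?sx0.
  by apply/esym/eq_sphere => //; rewrite isometry_dot.
have m2 : (2 <= m.+1)%N by exact: ltnW.
exists (u \o emb m2); split.
- by apply: class_C_emb uC2 => y; rewrite /halfspace/= emb0.
- exact: C1_closed_halfspace_emb.
move=> x1 x' x10; apply: eq_sphere.
- by rewrite /halfspace/= consr0.
- by rewrite emb0 !consr0.
- by rewrite emb_dot consr0 consr_lift mxE enorm_sqr consr_dot.
Qed.
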